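(* Every word $\mathsf{u}\in\mathcal{A}$ admits a unique rightmost equitable partition, i.e. there exists exactly one equitable partition $\mathsf{u}^*$ of $\mathsf{u}$ such that every equitable partition $\mathsf{v}^*$ of $\mathsf{u}$ satisfies $\mathsf{block}(\mathsf{v}^*,i)\ge\mathsf{block}(\mathsf{u}^*,i)$ for all $1\le i\le N$.
   Context: Fix positive integers $m,N$. Let $\mathcal{A}$ be the set of words $\mathsf{u}=\mathsf{u}_1\cdots\mathsf{u}_N$ of length $N$ over $\{0,1,\ldots,m-1\}$; write $|\mathsf{u}|=\sum_i\mathsf{u}_i$ and $|\mathsf{u}|_m=|\mathsf{u}|\bmod m\in\{0,\ldots,m-1\}$. A partitioned word of $\mathsf{u}$ is a decomposition $\mathsf{u}^*=\mathsf{u}^*_{m-1}|\mathsf{u}^*_{m-2}|\cdots|\mathsf{u}^*_0$ of $\mathsf{u}$ into $m$ possibly empty consecutive factors (blocks) whose concatenation $\mathsf{u}^*_{m-1}\cdots\mathsf{u}^*_0$ is $\mathsf{u}$; write $\mathsf{block}(\mathsf{u}^*,i)=k$ if the $i$-th letter $\mathsf{u}_i$ lies in block $\mathsf{u}^*_k$. The balancing array of $\mathsf{u}^*$ is the $N\times m$ array with rows $i=1,\ldots,N$ and columns $j=m-1,\ldots,0$ whose entry $(i,j)$ is filled iff $j\equiv\mathsf{block}(\mathsf{u}^*,i)-t\pmod m$ for some $0\le t\le\mathsf{u}_i-1$. Column $j$ is equitably filled if it has exactly $\lfloor|\mathsf{u}|/m\rfloor+1$ filled entries when $1\le j\le|\mathsf{u}|_m$,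 and exactly $\lfloor|\mathsf{u}|/m\rfloor$ filled entries when $j=0$ or $j>|\mathsf{u}|_m$. $\mathsf{u}^*$ is an equitable partition if all its columns are equitably filled. *)

(* Defs.v *)
From mathcomp Require Import all_boot.
Set Implicit Arguments.
Unset Strict Implicit.
Unset Printing Implicit Defensive.

(* Words are [u : N.-tuple 'I_m], with positions numbered from 0.  A tuple
   [p : m.-tuple (seq 'I_m)] lists blocks in reading order, so its entry of
   index [l] is the block called [m - 1 - l]. *)

Definition weight (m N : nat) (u : N.-tuple 'I_m) : nat :=
  \sum_(i < N) tnth u i.

Definition partitioned_word (m N : nat) (u : N.-tuple 'I_m)
    (p : m.-tuple (seq 'I_m)) : Prop :=
  flatten p = u.

(* [reshape_index (shape p) i] is the index in [p] of the sequence containing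
   the [i]-th item of [flatten p]. *)
Definition block (m : nat) (p : m.-tuple (seq 'I_m)) (i : nat) : nat :=
  m.-1 - reshape_index (shape p) i.

Definition filled (m N : nat) (u : N.-tuple 'I_m) (p : m.-tuple (seq 'I_m))
    (i : 'I_N) (j : 'I_m) : bool :=
  [exists t : 'I_(tnth u i), j + t == block p i %[mod m]].

Definition column_fill (m N : nat) (u : N.-tuple 'I_m)
    (p : m.-tuple (seq 'I_m)) (j : 'I_m) : nat :=
  #|[set i : 'I_N | filled u p i j]|.

Definition equitably_filled (m N : nat) (u : N.-tuple 'I_m)
    (p : m.-tuple (seq 'I_m)) (j : 'I_m) : Prop :=
  column_fill u p j =
    if 1 <= j <= weight u %% m then (weight u %/ m).+1 else weight u %/ m.

Definition equitable_partition (m N : nat) (u : N.-tuple 'I_m)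
    (p : m.-tuple (seq 'I_m)) : Prop :=
  partitioned_word u p /\ forall j : 'I_m, equitably_filled u p j.

Definition rightmost_equitable_partition (m N : nat) (u : N.-tuple 'I_m)
    (p : m.-tuple (seq 'I_m)) : Prop :=
  equitable_partition u p /\
  forall q : m.-tuple (seq 'I_m), equitable_partition u q ->
    forall i : 'I_N, block p i <= block q i.

(* Main.v *)
Require Import Defs.
From mathcomp Require Import all_boot.
From mathcomp Require Import zify.

Set Implicit Arguments.
Unset Strict Implicit.
Unset Printing Implicit Defensive.

(** A partitioned word is the same as a nonincreasing map [b] from positions to
    block names.  If the set of positions lying in blocks [>= j] is held fixed,
    then lowering [b] can only add filled cells to column [j].  Call [b]
    admissible if each column [j >= 1] is either filled at least as much as
    required, or has all positions in blocks [>= j].  Admissible maps contain the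
    equitable ones and are closed under pointwise minimum, so there is a least
    one.  Minimality means that no letter can move down a block, whence a column
    [j >= 1] is not overfilled unless all positions are in blocks [< j].
    Counting all filled cells then forces the least admissible map to be
    equitable. *)

(** * Sums, initial segments and block indices *)

Lemma eq_of_leq_sum (I : finType) (f g : I -> nat) :
  (forall i, f i <= g i) -> \sum_i f i = \sum_i g i -> forall i, f i = g i.
Proof.
move=> le_fg eq_sum i.
have := leqif_sum (P := predT) (fun i _ => leqif_eq (le_fg i)).
by case=> _; rewrite eq_sum eqxx => /esym/forallP/(_ i)/eqP.
Qed.

(** If [P i], the [i + 1] positions up to [i] all satisfy [P]; if not, only positions before [i]
    can. This turns level sets of monotone maps into thresholds. *)
Lemma downclosed_card (N : nat) (P : pred 'I_N) :
  (forall i j : 'I_N, i <= j -> P j -> P i) ->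
  forall i : 'I_N, P i = (i < #|P|).
Proof.
move=> down i; apply/idP/idP => [Pi | lt_iP].
  have <- : #|[pred j : 'I_N | j <= i]| = i.+1.
    rewrite -sum1_card (eq_bigl (fun j : 'I_N => j < i.+1)) //.
    by rewrite (big_ord_narrow (ltn_ord i)) sum1_card card_ord.
  by apply/subset_leq_card/subsetP => j; rewrite inE => /down; apply.
apply: contraLR lt_iP => nPi; rewrite -leqNgt.
have <- : #|[pred j : 'I_N | j < i]| = i.
  by rewrite -sum1_card (big_ord_narrow (ltnW (ltn_ord i))) sum1_card card_ord.
apply/subset_leq_card/subsetP => j Pj; rewrite inE ltnNge.
by apply: contra nPi => /down; apply.
Qed.

Lemma leq_reshape_index (sh : seq nat) (i r : nat) :
  r < size sh -> (reshape_index sh i <= r) = (i < sumn (take r.+1 sh)).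
Proof.
rewrite /reshape_index; elim: sh i r => [//|n sh IHsh] i r lt_r /=.
rewrite subn_eq0; case: ltnP => [lt_in | le_ni]; first by rewrite ltn_addr.
case: r lt_r => [|r] lt_r; first by rewrite take0 /= addn0 [RHS]ltnNge le_ni.
by rewrite subSn // ltnS IHsh // ltn_subLR // addnC.
Qed.

(** * Cell counts of columns and their targets *)

Section Balancing.

Variables (m N : nat) (u : N.-tuple 'I_m).

(* The block name of a letter is [x]; the letter fills the cell in column [j]
   iff this cyclic distance from [x] down to [j] is less than the letter. *)
Definition gap (x j : nat) : nat := if j <= x then x - j else x + m - j.

Definition fill (b : 'I_N -> 'I_m) (j : nat) : nat :=
  #|[set i : 'I_N | gap (b i) j < tnth u i]|.

Definition target (j : nat) : nat :=
  if 1 <= j <= weight u %% m then (weight u %/ m).+1 else weight u %/ m.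

Definition nonincreasing (b : 'I_N -> 'I_m) : Prop :=
  forall i j : 'I_N, i <= j -> b j <= b i.

Definition admissible (b : 'I_N -> 'I_m) : Prop :=
  nonincreasing b /\
  forall k : 'I_m, 0 < k -> (forall i, k <= b i) \/ target k <= fill b k.

Lemma exists_gap_filled (c j w : 'I_m) :
  [exists t : 'I_w, j + t == c %[mod m]] = (gap c j < w).
Proof.
have cm := ltn_ord c; have jm := ltn_ord j; have wm := ltn_ord w.
apply/existsP/idP => [[t] | lt_gw].
  have tw := ltn_ord t; rewrite (modn_small cm) /gap => /eqP.
  (* Since [j + t < 2 * m], reduction subtracts [m] at most once; the two cases are the two branches
     of [gap]. *)
  case: (ltnP (j + t) m) => [/modn_small -> <- | le_mjt].
    by rewrite leq_addr addKn.
  rewrite -(subnK le_mjt) modnDr modn_small; last by lia.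
  by move=> <-; case: ifP; lia.
exists (Ordinal lt_gw) => /=; move: lt_gw; rewrite /gap.
case: (leqP j c) => [le_jc | lt_cj] _ /=; first by rewrite subnKC.
by rewrite subnKC ?modnDr //; lia.
Qed.

(** As long as the block name does not cross [j], the same branch of [gap] applies, and that branch
    increases with the name. *)
Lemma fill_anti (x y : 'I_N -> 'I_m) (j : nat) :
  (forall i, x i <= y i) -> (forall i, (j <= x i) = (j <= y i)) ->
  fill y j <= fill x j.
Proof.
move=> le_xy eq_xy; apply/subset_leq_card/subsetP => i; rewrite !inE.
apply: leq_ltn_trans; have := le_xy i; have := eq_xy i.
by rewrite /gap; do 2!case: ifP; lia.
Qed.

Lemma fill_gap_anti (b : 'I_N -> 'I_m) (k l : nat) :
  (forall i, gap (b i) l <= gap (b i) k) -> fill b k <= fill b l.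
Proof.
move=> le_gap; apply/subset_leq_card/subsetP => i; rewrite !inE.
exact: leq_ltn_trans.
Qed.

(** Double counting: for a fixed position, [gap] permutes the columns, so a letter fills as many
    cells as its value. *)
Lemma sum_fill (b : 'I_N -> 'I_m) : \sum_(j < m) fill b j = weight u.
Proof.
under eq_bigr => j _ do rewrite /fill -sum1dep_card.
rewrite (exchange_big_dep predT) //= /weight; apply: eq_bigr => i _.
have gapP (j : 'I_m) : gap (b i) j < m.
  by rewrite /gap; have := ltn_ord j; have := ltn_ord (b i); case: ifP; lia.
pose h (j : 'I_m) := Ordinal (gapP j).
have h_inj : injective h.
  move=> j k /(congr1 val) /= eq_h; apply: val_inj => /=; move: eq_h.
  have := ltn_ord j; have := ltn_ord k; have := ltn_ord (b i).
  by rewrite /gap; do 2!case: ifP; lia.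
rewrite -(reindex_inj (P := fun j : 'I_m => j < tnth u i) (F := fun=> 1) h_inj) /=.
by rewrite (big_ord_narrow (ltnW (ltn_ord (tnth u i)))) sum1_card card_ord.
Qed.

Lemma sum_target : 0 < m -> \sum_(j < m) target j = weight u.
Proof.
move=> m_gt0; have lt_rm := ltn_pmod (weight u) m_gt0.
rewrite (eq_bigr (fun j : 'I_m =>
  weight u %/ m + (0 < j <= weight u %% m))); last first.
  by move=> j _; rewrite /target; case: ifP; rewrite ?addn1 ?addn0.
rewrite big_split /= sum_nat_const card_ord mulnC [RHS](divn_eq _ m).
congr (_ + _).
rewrite -(big_mkord predT (fun j => nat_of_bool (0 < j <= weight u %% m))).
rewrite big_ltn //= add0n (big_cat_nat (n := (weight u %% m).+1)) //=.
rewrite [X in _ + X]big_nat_cond [X in _ + X]big1 ?addn0.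
  rewrite big_nat_cond (eq_bigr (fun=> 1)).
    by rewrite -big_nat_cond sum_nat_const_nat muln1 subn1.
  by move=> j; rewrite andbT => /andP[j1 j2]; rewrite j1 -ltnS j2.
by move=> j; rewrite andbT => /andP[j1 j2]; rewrite [j <= _]leqNgt j1 andbF.
Qed.

Lemma target_anti (k l : nat) : 0 < k <= l -> target l <= target k.
Proof. by rewrite /target; do 2!case: ifP; lia. Qed.

Lemma target0_leq (k : nat) : target 0 <= target k.
Proof. by rewrite /target; case: ifP. Qed.

Lemma target_leqS (k : nat) : target k <= (target 0).+1.
Proof. by rewrite /target; case: ifP. Qed.

(** * The least admissible map *)

Lemma nonincreasing_chain (x y : 'I_N -> 'I_m) (k : nat) :
  nonincreasing x -> nonincreasing y ->
  (forall i, k <= x i -> k <= y i) \/ (forall i, k <= y i -> k <= x i).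
Proof.
move=> decx decy.
case: (boolP [forall i, (k <= x i) ==> (k <= y i)]) => [/forallP le_xy|].
  by left=> i; apply/implyP.
case/forallPn => i; rewrite negb_imply -ltnNge => /andP[le_kx lt_yk].
(* A position where [y] reaches [k] must precede [i], and [x] is at least [k] up to [i]. *)
right=> j le_ky; case: (leqP i j) => [/decy | /ltnW/decx]; lia.
Qed.

Definition minfun (x y : 'I_N -> 'I_m) : {ffun 'I_N -> 'I_m} :=
  [ffun i => if x i <= y i then x i else y i].

Lemma minfunC (x y : 'I_N -> 'I_m) : minfun x y = minfun y x.
Proof. by apply/ffunP=> i; rewrite !ffunE; case: ltngtP => // /val_inj. Qed.

(** The sets where [x] and [y] are at least [k] are nested, and the minimum has the smaller one as
    its own such set. The map owning that set passes its alternative on, through [fill_anti] in the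
    second case. *)
Lemma admissible_min (x y : 'I_N -> 'I_m) :
  admissible x -> admissible y -> admissible (minfun x y).
Proof.
move=> [decx admx] [decy admy]; split.
  move=> i j le_ij; have := decx _ _ le_ij; have := decy _ _ le_ij.
  by rewrite !ffunE; do 2!case: ifP; lia.
move=> k k_gt0; wlog le_xy : x y decx decy admx admy /
    forall i, k <= x i -> k <= y i.
  move=> hw; have [|] := nonincreasing_chain k decx decy; first exact: hw.
  by rewrite minfunC; apply: hw.
have [lt_kx | le_fx] := admx k k_gt0; [left=> i | right].
  by have := lt_kx i; have := le_xy i; rewrite ffunE; case: ifP; lia.
apply: leq_trans le_fx _; apply: fill_anti => i; rewrite ffunE.
  by case: ifP; lia.
by have := le_xy i; case: ifP; lia.
Qed.

Lemma exists_least_admissible : 0 < m ->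
  exists2 b : {ffun 'I_N -> 'I_m}, admissible b &
    forall q, admissible q -> forall i, b i <= q i.
Proof.
move=> m_gt0.
pose adm (b : {ffun 'I_N -> 'I_m}) :=
  [forall i : 'I_N, forall j : 'I_N, (i <= j) ==> (b j <= b i)] &&
  [forall k : 'I_m, (0 < k) ==>
    [forall i, k <= b i] || (target k <= fill b k)].
have admP (b : {ffun 'I_N -> 'I_m}) : reflect (admissible b) (adm b).
  apply: (iffP andP) => [[/forallP dec /forallP ok] | [dec ok]]; split.
  - by move=> i j; move/(_ i)/forallP/(_ j)/implyP: dec; apply.
  - move=> k k_gt0; have /implyP/(_ k_gt0)/orP[/forallP|] := ok k; by [left|right].
  - by apply/forallP=> i; apply/forallP=> j; apply/implyP; apply: dec.
  - apply/forallP=> k; apply/implyP=> /ok[all_k | ->]; last by rewrite orbT.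
    by apply/orP; left; apply/forallP.
have lt_pm : m.-1 < m by rewrite prednK.
pose top : {ffun 'I_N -> 'I_m} := [ffun=> Ordinal lt_pm].
have adm_top : adm top.
  apply/admP; split=> [i j _ | k _]; first by rewrite !ffunE.
  by left=> i; rewrite ffunE /= -ltnS prednK.
(* A minimizer of the sum of block names is least pointwise: its minimum with [q] is admissible, so
   it cannot have a smaller sum. *)
case: (arg_minnP (fun b : {ffun 'I_N -> 'I_m} => \sum_i b i) adm_top).
move=> b /admP admb min_b; exists b => // q admq i.
have le_min j : minfun b q j <= b j by rewrite ffunE; case: ifP => //; lia.
have /admP/min_b le_sum := admissible_min admb admq.
have eq_sum : \sum_j minfun b q j = \sum_j b j.
  by apply/eqP; rewrite eqn_leq le_sum leq_sum.
have := eq_of_leq_sum le_min eq_sum i.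
by rewrite ffunE; case: ifP; lia.
Qed.

(** * Balance of the least admissible map *)

Section Least.

Variable b : {ffun 'I_N -> 'I_m}.
Hypothesis adm_b : admissible b.
Hypothesis least_b : forall q, admissible q -> forall i, b i <= q i.

(* Moving the last letter of block [k] down one block cannot stay admissible. *)
Lemma least_fill_nonempty (i0 : 'I_N) : 0 < b i0 -> fill b (b i0) <= target (b i0).
Proof.
set k := b i0 => k_gt0.
have [decb okb] := adm_b.
(* Lowering the last position of block [k] keeps the map nonincreasing. *)
case: (@arg_maxnP _ i0 (fun i => b i == k) (@nat_of_ord N) (eqxx k)).
move=> i /eqP bi last_i.
have lt_pm : k.-1 < m by rewrite (leq_ltn_trans (leq_pred _)).
pose q : {ffun 'I_N -> 'I_m} := [ffun j => if j == i then Ordinal lt_pm else b j].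
rewrite leqNgt; apply/negP => gt_fill.
suff /least_b/(_ i) : admissible q by rewrite ffunE eqxx bi /=; lia.
have le_qb j : q j <= b j by rewrite ffunE; case: eqP => // ->; rewrite bi leq_pred.
split=> [j l le_jl | l l_gt0].
  have := decb _ _ le_jl; rewrite !ffunE.
  case: (eqVneq j i) => [eq_ji | ne_ji]; case: (eqVneq l i) => [eq_li | ne_li] //=.
  - rewrite eq_ji bi => le_bl.
    suff : b l != k by rewrite -val_eqE /=; lia.
    apply: contraNneq ne_li => /eqP/last_i le_li.
    by apply/eqP/val_inj; move: le_li le_jl; rewrite eq_ji /=; lia.
  - by rewrite eq_li bi; apply: leq_trans; exact: leq_pred.
(* Column [k] was overfilled and loses at most one cell. For [l != k], the names [k] and [k - 1] lie
   on the same side of [l], so [fill_anti] applies. *)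
case: (eqVneq l k) => [-> | ne_lk]; [right | ].
  rewrite -ltnS; apply: leq_trans gt_fill _.
  rewrite [leqLHS](cardsD1 i) -[leqRHS]add1n leq_add ?leq_b1 //.
  apply/subset_leq_card/subsetP => j; rewrite !inE ffunE.
  by case: eqVneq.
have eq_qb j : (l <= q j) = (l <= b j).
  rewrite ffunE; case: eqP => // ->; rewrite bi /=.
  by move: ne_lk; rewrite -val_eqE /=; lia.
have [all_l | le_tf] := okb l l_gt0; [by left=> j; rewrite eq_qb | right].
by apply: leq_trans le_tf _; exact: fill_anti.
Qed.

(** Let [b i] be the lowest occupied block name that is at least [k]. No letter lies in between, so
    column [b i] is at least as full as column [k], while its target is no larger. *)
Lemma least_fill (k : nat) (i0 : 'I_N) :
  0 < k <= b i0 -> fill b k <= target k.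
Proof.
case/andP=> k_gt0 le_kb.
case: (@arg_minnP _ i0 (fun i => k <= b i) (fun i => b i) le_kb) => i le_ki min_i.
apply: (@leq_trans (fill b (b i))).
  apply: fill_gap_anti => j; have := min_i j; have := ltn_ord (b j).
  have := ltn_ord (b i).
  by rewrite /gap; do 2!case: ifP; lia.
apply: leq_trans (least_fill_nonempty _) _; first exact: leq_trans le_ki.
by rewrite target_anti // k_gt0.
Qed.

(** Column [0] decides the direction: if it is not overfilled, no column exceeds its target; if it
    is, none falls short. The totals agree, so equality holds throughout. *)
Lemma least_balanced : 0 < m -> forall j : 'I_m, fill b j = target j.
Proof.
move=> m_gt0; have eq_sum := etrans (sum_fill b) (esym (sum_target m_gt0)).
case: (leqP (fill b 0) (target 0)) => [le_f0 | gt_f0] j.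
  apply: (eq_of_leq_sum (f := fun j : 'I_m => fill b j)) eq_sum j => k.
  case: (posnP k) => [-> // | k_gt0].
  case: (boolP [exists i, k <= b i]) => [/existsP[i le_kb] | /existsPn lt_bk].
    by apply: (@least_fill _ i); rewrite k_gt0.
  (* With every letter in a block below [k], each is cyclically at least as close to column [0] as
     to column [k]. *)
  apply: leq_trans (leq_trans le_f0 (target0_leq k)).
  apply: fill_gap_anti => i; have := lt_bk i; have := ltn_ord k.
  by rewrite /gap leq0n; case: ifP; lia.
symmetry; apply: (eq_of_leq_sum (g := fun j : 'I_m => fill b j)) (esym eq_sum) j.
move=> k; case: (posnP k) => [-> | k_gt0]; first exact: ltnW.
have [_ /(_ k k_gt0)[le_kb | //]] := adm_b.
apply: leq_trans (target_leqS k) (leq_trans gt_f0 _).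
by apply: fill_gap_anti => i; have := le_kb i; rewrite /gap leq0n; case: ifP; lia.
Qed.

End Least.

Lemma exists_least_balanced : 0 < m ->
  exists b : {ffun 'I_N -> 'I_m},
  [/\ nonincreasing b, forall j : 'I_m, fill b j = target j &
    forall q : 'I_N -> 'I_m, nonincreasing q ->
      (forall j : 'I_m, fill q j = target j) -> forall i, b i <= q i].
Proof.
move=> m_gt0; have [b adm_b least_b] := exists_least_admissible m_gt0.
exists b; split; [exact: adm_b.1 | exact: least_balanced | move=> q decq balq].
by apply: least_b; split=> // k _; right; rewrite balq.
Qed.

(** * Passing between partitioned words and maps *)

Lemma block_ord_subproof (p : m.-tuple (seq 'I_m)) (i : nat) :
  0 < m -> block p i < m.
Proof. by move=> m_gt0; rewrite /block; lia. Qed.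

Lemma column_fillE (p : m.-tuple (seq 'I_m)) (b : 'I_N -> 'I_m) (j : 'I_m) :
  (forall i : 'I_N, block p i = b i) -> column_fill u p j = fill b j.
Proof.
move=> eq_b; rewrite /column_fill /fill; apply: eq_card => i.
by rewrite !inE /filled eq_b exists_gap_filled.
Qed.

Lemma sumn_shape_partitioned (p : m.-tuple (seq 'I_m)) :
  partitioned_word u p -> sumn (shape p) = N.
Proof. by move=> pP; rewrite -size_flatten pP size_tuple. Qed.

Lemma reshape_index_partitioned (p : m.-tuple (seq 'I_m)) (i : 'I_N) :
  partitioned_word u p -> reshape_index (shape p) i < m.
Proof.
move=> pP; have := @reshape_indexP (shape p) i.
by rewrite sumn_shape_partitioned // size_map size_tuple; apply.
Qed.

Lemma block_nonincreasing (p : m.-tuple (seq 'I_m)) (i j : nat) :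
  i <= j -> block p j <= block p i.
Proof. by rewrite (reshape_leq (shape p)) /block => ?; lia. Qed.

Lemma block_inj (p q : m.-tuple (seq 'I_m)) :
  partitioned_word u p -> partitioned_word u q ->
  (forall i : 'I_N, block p i = block q i) -> p = q.
Proof.
move=> pP qP eq_pq; apply: val_inj; apply: eq_from_flatten_shape => /=.
  by rewrite pP qP.
have eq_size : size (shape p) = size (shape q) by rewrite !size_map !size_tuple.
have eq_idx (i : 'I_N) : reshape_index (shape p) i = reshape_index (shape q) i.
  have := eq_pq i; have := reshape_index_partitioned i pP.
  by have := reshape_index_partitioned i qP; rewrite /block; lia.
(* The shape is recovered from its partial sums. Indices are compared only at positions below [N],
   which suffices because partial sums are at most [N]. *)
have le_take (sh : seq nat) r : sumn (take r sh) <= sumn sh.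
  by rewrite -[in leqRHS](cat_take_drop r sh) sumn_cat leq_addr.
have eq_take r : r <= size (shape p) ->
    sumn (take r (shape p)) = sumn (take r (shape q)).
  case: r => [|r] lt_r; first by rewrite !take0.
  have iff_lt i : i < N ->
      (i < sumn (take r.+1 (shape p))) = (i < sumn (take r.+1 (shape q))).
    move=> lt_iN; rewrite -!leq_reshape_index -?eq_size //.
    by have /= -> := eq_idx (Ordinal lt_iN).
  have := le_take (shape p) r.+1; have := le_take (shape q) r.+1.
  rewrite !sumn_shape_partitioned //.
  move: (sumn _) (sumn _) iff_lt => c a iff_lt le_cN le_aN.
  case: (ltngtP a c) => // lt_ac.
    by have := iff_lt _ (leq_trans lt_ac le_cN); rewrite ltnn lt_ac.
  by have := iff_lt _ (leq_trans lt_ac le_aN); rewrite ltnn lt_ac.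
apply: (@eq_from_nth _ 0) => // r lt_r.
have := eq_take _ lt_r; rewrite !(take_nth 0) -?eq_size // !sumn_rcons.
by rewrite (eq_take _ (ltnW lt_r)) => /addnI.
Qed.

Lemma exists_partitioned (b : 'I_N -> 'I_m) : nonincreasing b ->
  exists2 p : m.-tuple (seq 'I_m), partitioned_word u p &
    forall i : 'I_N, block p i = b i.
Proof.
move=> decb.
(* Block lengths are the sizes of the level sets of [b], in reading order. *)
pose sh := mkseq (fun l => #|[pred i : 'I_N | m.-1 - b i == l]|) m.
have sumn_take r : r <= m ->
    sumn (take r sh) = #|[pred i : 'I_N | m.-1 - b i < r]|.
  elim: r => [|r IHr] lt_r; first by rewrite take0 eq_card0.
  rewrite (take_nth 0) ?size_mkseq // sumn_rcons IHr 1?ltnW // nth_mkseq //.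
  rewrite -cardUI [X in _ + X]eq_card0 ?addn0.
    by apply: eq_card => i; rewrite !inE /= [RHS]ltnS [RHS]leq_eqVlt orbC.
  by move=> i; rewrite !inE /=; case: ltngtP.
have lt_bm i : m.-1 - b i < m by have := ltn_ord (b i); lia.
have sumn_sh : sumn sh = N.
  have := sumn_take m (leqnn m); rewrite take_oversize ?size_mkseq // => ->.
  by rewrite -[RHS]card_ord; apply: eq_card => i; rewrite !inE lt_bm.
have size_p : size (reshape sh u) == m by rewrite size_reshape size_mkseq.
exists (Tuple size_p); first by rewrite /partitioned_word reshapeKr // sumn_sh size_tuple.
move=> i; rewrite /block /= reshapeKl ?sumn_sh ?size_tuple //.
suff -> : reshape_index sh i = m.-1 - b i by have := ltn_ord (b i); lia.
have idx_leq r : r < m -> (reshape_index sh i <= r) = (m.-1 - b i <= r).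
  move=> lt_r; rewrite leq_reshape_index ?size_mkseq // sumn_take //.
  (* As [b] is nonincreasing, these positions form an initial segment, determined by its size. *)
  rewrite -(@downclosed_card _ [pred i : 'I_N | m.-1 - b i < r.+1]) //.
  by move=> j l /decb /=; rewrite !ltnS; lia.
have lt_idx : reshape_index sh i < m.
  by have := @reshape_indexP sh i; rewrite sumn_sh size_mkseq; apply.
by apply/eqP; rewrite eqn_leq idx_leq ?lt_bm // leqnn -idx_leq /=.
Qed.

End Balancing.

Theorem theorem4p4 (m N : nat) (m_gt0 : 0 < m) (N_gt0 : 0 < N)
    (u : N.-tuple 'I_m) :
  exists! p : m.-tuple (seq 'I_m), rightmost_equitable_partition u p.
Proof.
have [b [decb balb least_b]] := exists_least_balanced u m_gt0.
have [p pP block_p] := exists_partitioned u decb.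
have eqp : equitable_partition u p.
  by split=> // j; rewrite /equitably_filled (column_fillE _ _ block_p) balb.
exists p; split.
  split=> // q [qP balq] i; rewrite block_p.
  pose c (i : 'I_N) := Ordinal (block_ord_subproof q i m_gt0).
  apply: (least_b c) => [j k | j]; first exact: block_nonincreasing.
  by rewrite -(@column_fillE _ _ u q) // balq.
(* Each of [p] and [q] bounds the other from below, so their block maps agree. *)
move=> q [eqq least_q]; have [qP _] := eqq.
apply: (@block_inj _ _ u) => // i; apply/eqP; rewrite eqn_leq least_q // andbT.
rewrite block_p; pose c (i : 'I_N) := Ordinal (block_ord_subproof q i m_gt0).
apply: (least_b c) => [j k | j]; first exact: block_nonincreasing.
by rewrite -(@column_fillE _ _ u q) // eqq.2.
Qed.
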